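(* Let $C$ be a field of characteristic different from $3$ equipped with an absolute value, and let $f(t) = t^3 + pt + q \in C[t]$ with $p \neq 0$ and $q \ne 0$. Let $\Delta = -4p^3 - 27q^2$ be the discriminant of $f$. If the series $$\sum_{n \ge 0} \binom{3n}{n}\left( \frac{-\Delta}{27 p^3} \right)^{n}$$ converges unconditionally to $\lambda \in C$, then $$f(\alpha) = 0 \quad\text{for}\quad \alpha := \frac{3q}{p}\,\lambda \in C.$$
   Context: An absolute value on a field $C$ is a map $|\cdot|\colon C \to \mathbb{R}_{\ge 0}$ with $|x| = 0$ iff $x = 0$, $|xy| = |x||y|$, and $|x+y| \le |x|+|y|$. (It may be archimedean or non-archimedean, and $C$ is not assumed complete.) Convergence of series is with respect to the metric $|x-y|$. A series in $C$ converges unconditionally to $\lambda$ if every rearrangement of it converges to $\lambda$. Integers such as $\binom{3n}{n}$ are interpreted in $C$ via $\mathbb{Z} \to C$. *)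

(* Defs.v *)
From HB Require Import structures.
From mathcomp Require Import all_boot all_order all_algebra.
From mathcomp Require Import all_classical all_reals all_analysis.

Set Implicit Arguments.
Unset Strict Implicit.
Unset Printing Implicit Defensive.

Import Order.TTheory GRing.Theory Num.Theory.
Import numFieldNormedType.Exports.

Local Open Scope classical_set_scope.
Local Open Scope ring_scope.

(* The order and norm structures of the library are not used on C: a field with
   an arbitrary (possibly non-archimedean) absolute value is not a
   numDomainType. *)
Record absval (R : realType) (C : fieldType) := AbsVal {
  absval_fun :> C -> R ;
  absval_ge0 : forall x, 0 <= absval_fun x ;
  absval_eq0 : forall x, absval_fun x = 0 <-> x = 0 ;
  absvalM : forall x y, absval_fun (x * y) = absval_fun x * absval_fun y ;
  absvalD : forall x y, absval_fun (x + y) <= absval_fun x + absval_fun y }.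

(* An alias of C, so that the metric attached to v can be inferred. *)
Definition absval_space (R : realType) (C : fieldType) (v : absval R C) : Type :=
  C.

Section AbsvalMetric.
Context (R : realType) (C : fieldType) (v : absval R C).

Lemma absval1 : v 1 = 1.
Proof.
have v1 : v 1 != 0 by apply/eqP => /absval_eq0/eqP; rewrite oner_eq0.
by apply: (mulfI v1); rewrite -absvalM !mulr1.
Qed.

Lemma absvalN x : v (- x) = v x.
Proof.
have vN1 : v (-1) = 1.
  apply/eqP; rewrite -(@pexpr_eq1 _ _ 2) ?absval_ge0 //.
  by rewrite expr2 -absvalM mulrNN mulr1 absval1.
by rewrite -mulN1r absvalM vN1 mul1r.
Qed.

Let dist (x y : absval_space v) : R := v ((x : C) - (y : C)).

Let distxx x : dist x x = 0.
Proof. by apply/absval_eq0; rewrite subrr. Qed.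

Let dist_positivity x y : dist x y = 0 -> x = y.
Proof. by move/absval_eq0 => /eqP; rewrite subr_eq0 => /eqP. Qed.

Let dist_sym x y : dist x y = dist y x.
Proof. by rewrite /dist -absvalN opprB. Qed.

Let dist_triangle y x z : dist x z <= dist x y + dist y z.
Proof.
by apply: le_trans (absvalD _ _ _); rewrite /dist addrA subrK.
Qed.

HB.instance Definition _ := Choice.copy (absval_space v) C.
HB.instance Definition _ := @isMetric.Build R (absval_space v)
  dist distxx dist_positivity dist_sym dist_triangle.

Lemma absval_mdistE (x y : absval_space v) :
  mdist x y = v ((x : C) - (y : C)).
Proof. by []. Qed.

End AbsvalMetric.

Definition series_cvg (R : realType) (C : fieldType) (v : absval R C)
    (a : nat -> C) (l : C) : Prop :=
  (series a : nat -> absval_space v) @ \oo --> (l : absval_space v).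

Definition unconditional_cvg (R : realType) (C : fieldType) (v : absval R C)
    (a : nat -> C) (l : C) : Prop :=
  forall s : nat -> nat, bijective s -> series_cvg v (a \o s) l.

Lemma series_cvgP (R : realType) (C : fieldType) (v : absval R C)
    (a : nat -> C) (l : C) :
  series_cvg v a l <->
  forall e : R, 0 < e -> exists N : nat, forall n : nat, (N <= n)%N ->
    v ((\sum_(0 <= k < n) a k) - l) < e.
Proof.
rewrite /series_cvg; split => [/cvg_ballP al e e0|al].
  have [N _ NP] := al e e0; exists N => n Nn.
  by have := NP n Nn; rewrite /= ballEmdist /= absval_mdistE -absvalN opprB.
apply/cvg_ballP => e e0; have [N NP] := al e e0; exists N => // n /= Nn.
by rewrite ballEmdist /= absval_mdistE -absvalN opprB; exact: NP.
Qed.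

(* Main.v *)
Require Import Defs.
From mathcomp Require Import all_boot all_order all_algebra.
From mathcomp Require Import all_classical all_reals all_analysis.
From mathcomp Require Import ring lra zify.

(** With x := - Delta / (27 p^3) one has 27 x - 4 = 27 q^2 / p^3, so that
    f(alpha) = q ((27 x - 4) lambda^3 + 3 lambda + 1).  Everything thus reduces
    to the vanishing at lambda of the cubic (27 x - 4) b^3 + 3 b + 1, where
    lambda is the sum of the series B(x) = sum_n 'C(3n, n) x^n.

    As a formal power series B does satisfy this cubic.  The proof uses the
    whole family E_a = sum_n 'C(3n + a, n) X^n, for which Pascal's rule reads
    E_(a+1) = E_a + X E_(a+3).  By induction on the coefficient this rule alone
    gives E_(a+c) E_b = E_a E_(b+c), so that E_a = T^a B with T = E_1 / B.  The
    cases T = 1 + X T^3 (Pascal for a = 0) and B = 1 + 3 X T^2 B (absorption)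
    then eliminate T.  All this is done with truncated polynomials modulo X^N
    ([dvdXn_cubic_poly]).

    What remains is to pass from the formal identity to the values at x, in a
    field that need not be complete.  Two cases are distinguished by the size
    of 2, which decides whether the absolute value is ultrametric.

    If |2| <= 1, binary expansion of integers shows that |n| <= 1 for every
    integer n, whence the ultrametric inequality ([absval_ultra]).  The terms
    of the series tend to 0, hence so does the Gauss norm of the part of the
    cubic expression that the truncation leaves ([cubic_truncation_cvg]).

    If |2| > 1, the series is damped: x is replaced by r x with
    r = 1 - 2^-k.  Then |r| < 1 ([absval_mersenne]), and as the terms of the
    original series are bounded, the damped series converges absolutely, which
    makes the value of the cubic at its partial sums tend to 0.  To let k go to
    infinity one needs an analogue of Abel's theorem: the damped partial sums
    must be close to lambda uniformly in k.  Abel summation is not available,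
    since |1 - r| can be much larger than 1 - |r|; here unconditional
    convergence takes over.  It bounds every finite subsum of a tail of the
    series by some small d ([unconditional_tail]), and a sum of a_i m_i / 2^L
    with integers 0 <= m_i <= 2^L splits along the binary digits of the m_i into
    subsums weighted by powers of 2, of total size at most
    d |2| / (|2| - 1) ([absval_digits], [damped_block]).

    In both cases points close to (x, lambda) are found at which the cubic is
    small, and the cubic is continuous ([cubic_closed]). *)

Set Implicit Arguments.
Unset Strict Implicit.
Unset Printing Implicit Defensive.

Import Order.TTheory GRing.Theory Num.Theory.
Local Open Scope ring_scope.

(** * The cubic equation of the generating series *)

Definition bin3 (a n : nat) : nat := 'C(3 * n + a, n).

Lemma bin3_0 a : bin3 a 0 = 1%N.
Proof. by rewrite /bin3 bin0. Qed.

Lemma bin3S a n : bin3 a.+1 n.+1 = (bin3 a n.+1 + bin3 (a + 3) n)%N.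
Proof.
rewrite /bin3 addnS binS; congr ('C(_, _) + 'C(_, _))%N; lia.
Qed.

Lemma bin3_0S n : bin3 0 n.+1 = (3 * bin3 2 n)%N.
Proof.
rewrite /bin3 addn0.
apply/eqP; rewrite -(@eqn_pmul2l n.+1) // -mul_bin_diag; apply/eqP.
have -> : ((3 * n.+1).-1 = 3 * n + 2)%N by lia.
by rewrite mulnCA mulnA.
Qed.

Definition bin3_conv (n a b : nat) : nat :=
  \sum_(i < n.+1) bin3 a i * bin3 b (n - i).

Lemma bin3_convC n a b : bin3_conv n a b = bin3_conv n b a.
Proof.
rewrite /bin3_conv (reindex_inj rev_ord_inj) /=; apply: eq_bigr => i _.
by rewrite subSS subKn 1?mulnC // -ltnS.
Qed.

Lemma bin3_convS n a b :
  bin3_conv n.+1 a.+1 b = (bin3_conv n.+1 a b + bin3_conv n (a + 3) b)%N.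
Proof.
rewrite /bin3_conv !(big_ord_recl n.+1) !bin3_0 -addnA.
congr addn; rewrite -big_split; apply: eq_bigr => i _ /=.
by rewrite /bump /= add1n bin3S mulnDl subSS.
Qed.

(** Moving one unit from a to b changes the n-th coefficient of E_a E_b by that
    of X (E_(a+3) E_b - E_a E_(b+3)), a difference which moves three units in a
    lower coefficient, so that induction on n applies. *)
Lemma bin3_conv_shift n a b : bin3_conv n a.+1 b = bin3_conv n a b.+1.
Proof.
elim: n a b => [|n IHn] a b; first by rewrite /bin3_conv !big_ord1 !bin3_0.
rewrite bin3_convS [RHS]bin3_convC bin3_convS [bin3_conv n.+1 b a]bin3_convC; congr addn.
by rewrite [RHS]bin3_convC !addnS !addn0 !IHn.
Qed.

Lemma bin3_convD n a b c : bin3_conv n (a + c) b = bin3_conv n a (b + c).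
Proof.
by elim: c b => [|c IHc] b; rewrite ?addn0 // addnS bin3_conv_shift IHc addSnnS.
Qed.

Section CubicIdentity.
Context (C : fieldType).
Implicit Types p u : {poly C}.

Lemma dvdXnP N p :
  reflect (forall m, (m < N)%N -> p`_m = 0) ('X^N %| p).
Proof.
apply: (iffP idP) => [/dvdpP[h ->] m mN|p0]; first by rewrite coefMXn mN.
rewrite -[p](poly_take_drop N) (_ : take_poly N p = 0) ?add0r ?dvdp_mull//.
by apply/polyP => m; rewrite coef_take_poly coef0; case: ifP => // /p0.
Qed.

Lemma dvdXn_cancel N u p : u`_0 != 0 -> 'X^N %| u * p -> 'X^N %| p.
Proof.
move=> u0; rewrite Gauss_dvdpr // coprimep_expl //.
rewrite coprimep_sym; have := coprimep_XsubC u 0.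
by rewrite polyC0 subr0 => ->; rewrite /root horner_coef0.
Qed.

Definition bin3_poly (N a : nat) : {poly C} := \poly_(i < N) (bin3 a i)%:R.

Definition cubic (y b : C) : C := (27 * y - 4) * b ^+ 3 + 3 * b + 1.

(** The cubic is evaluated at a truncation of E_0 and not truncated itself, so
    that its value at a point y is the cubic at the partial sum of the series. *)
Definition cubic_poly (N : nat) : {poly C} :=
  (27 *: 'X - 4%:P) * bin3_poly N 0 ^+ 3 + 3 *: bin3_poly N 0 + 1.

Lemma coef_bin3_polyM N a b m : (m < N)%N ->
  (bin3_poly N a * bin3_poly N b)`_m = (bin3_conv m a b)%:R.
Proof.
move=> mN; rewrite coefM /bin3_conv natr_sum; apply: eq_bigr => i _.
rewrite !coef_poly natrM !ifT//; have := ltn_ord i; lia.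
Qed.

Lemma bin3_polyM N a b c :
  'X^N %| bin3_poly N (a + c) * bin3_poly N b - bin3_poly N a * bin3_poly N (b + c).
Proof.
by apply/dvdXnP => m mN; rewrite coefB !coef_bin3_polyM // bin3_convD subrr.
Qed.

Lemma bin3_poly_pascal N : 'X^N %| bin3_poly N 1 - bin3_poly N 0 - 'X * bin3_poly N 3.
Proof.
apply/dvdXnP => -[|m] mN; rewrite !coefB coefXM !coef_poly mN /=.
  by rewrite !bin3_0 subr0 subrr.
by rewrite (ltnW mN) bin3S natrD add0n; ring.
Qed.

Lemma bin3_poly_absorption N : 'X^N %| bin3_poly N 0 - 1 - 3 * 'X * bin3_poly N 2.
Proof.
apply/dvdXnP => -[|m] mN; rewrite !coefB -mulrA -[3]/(3%:R)
  mulr_natl coefMn coefXM !coef_poly mN /=.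
  by rewrite !bin3_0 coef1 mul0rn subr0 subrr.
by rewrite (ltnW mN) bin3_0S mulnC coef1 subr0 natrM mulr_natr subrr.
Qed.

(** Elimination of T without division: A = T B and B^2 - B = 3 X A^2 combine
    with Pascal's rule to A (2 B + 1) = 3 B^2, that is T = 3 B / (2 B + 1), and
    substituting this back gives B times the cubic.  Factors B may be cancelled
    modulo X^N because B has constant term 1. *)
Lemma dvdXn_cubic_poly N : 'X^N %| cubic_poly N.
Proof.
case: N => [|N]; first by rewrite expr0 dvd1p.
set B := bin3_poly N.+1 0; set A := bin3_poly N.+1 1.
have B0 : B`_0 != 0 by rewrite coef_poly /= bin3_0 oner_neq0.
have e1 := bin3_poly_pascal N.+1; have e0 := bin3_poly_absorption N.+1.
have e11 : 'X^(N.+1) %| A * A - B * bin3_poly N.+1 2 := bin3_polyM N.+1 0 1 1.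
have e12 : 'X^(N.+1) %| A * bin3_poly N.+1 2 - B * bin3_poly N.+1 3 := bin3_polyM N.+1 0 2 1.
(* With T = A / B, h1 says that B = 1 + 3 X T^2 B and h2 that T = 1 + X T^3. *)
have h1 : 'X^(N.+1) %| B ^+ 2 - B - 3 * 'X * A ^+ 2.
  have -> : B ^+ 2 - B - 3 * 'X * A ^+ 2 =
    B * (B - 1 - 3 * 'X * bin3_poly N.+1 2) - 3 * 'X * (A * A - B * bin3_poly N.+1 2) by ring.
  by rewrite dvdp_sub // dvdp_mull.
have h2 : 'X^(N.+1) %| A * B ^+ 2 - B ^+ 3 - 'X * A ^+ 3.
  have -> : A * B ^+ 2 - B ^+ 3 - 'X * A ^+ 3 =
    B ^+ 2 * (A - B - 'X * bin3_poly N.+1 3)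
    - 'X * B * (A * bin3_poly N.+1 2 - B * bin3_poly N.+1 3)
    - 'X * A * (A * A - B * bin3_poly N.+1 2) by ring.
  by rewrite !dvdp_sub // dvdp_mull.
have h3 : 'X^(N.+1) %| A * (2 * B + 1) - 3 * B ^+ 2.
  apply: (@dvdXn_cancel _ B) => //.
  have -> : B * (A * (2 * B + 1) - 3 * B ^+ 2) =
    3 * (A * B ^+ 2 - B ^+ 3 - 'X * A ^+ 3) - A * (B ^+ 2 - B - 3 * 'X * A ^+ 2) by ring.
  by rewrite dvdp_sub // dvdp_mull.
apply: (@dvdXn_cancel _ B) => //.
rewrite /cubic_poly -/B -!mul_polyC.
have -> : B * ((27%:P * 'X - 4%:P) * B ^+ 3 + 3%:P * B + 1) =
  - (2 * B + 1) ^+ 2 * (B ^+ 2 - B - 3 * 'X * A ^+ 2)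
  - 3 * 'X * (A * (2 * B + 1) + 3 * B ^+ 2) * (A * (2 * B + 1) - 3 * B ^+ 2).
  have -> : (27%:P : {poly C}) = 27 by rewrite polyC_natr.
  have -> : (4%:P : {poly C}) = 4 by rewrite polyC_natr.
  have -> : (3%:P : {poly C}) = 3 by rewrite polyC_natr.
  by ring.
by rewrite dvdp_sub // dvdp_mull.
Qed.

Lemma horner_cubic_poly N y : (cubic_poly N).[y] = cubic y (bin3_poly N 0).[y].
Proof. by rewrite /cubic_poly /cubic !hornerE. Qed.

Lemma size_cubic_poly N : (0 < N)%N -> (size (cubic_poly N) <= 3 * N)%N.
Proof.
move=> N0; have sB : (size (bin3_poly N 0) <= N)%N by exact: size_poly.
rewrite /cubic_poly !(leq_trans (size_polyD _ _)) // geq_max; apply/andP; split; last first.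
  by rewrite size_poly1; lia.
rewrite (leq_trans (size_polyD _ _)) // geq_max; apply/andP; split; last first.
  by rewrite (leq_trans (size_scale_leq _ _)) // (leq_trans sB) //; lia.
have s1 : (size (27 *: 'X - 4%:P : {poly C})%R <= 2)%N.
  rewrite (leq_trans (size_polyD _ _)) // geq_max size_polyN.
  rewrite (leq_trans (size_scale_leq _ _)) ?size_polyX //.
  by rewrite (leq_trans (size_polyC_leq1 _)).
have s2 := size_poly_exp_leq (bin3_poly N 0) 3.
by rewrite (leq_trans (size_polyMleq _ _)) //; lia.
Qed.

End CubicIdentity.

(** * Powers and geometric sums of real numbers *)

Section RealSequences.
Context (R : realType).
Implicit Types t c : R.

Lemma bernoulli_ge t n : 0 <= t -> 1 + n%:R * t <= (1 + t) ^+ n.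
Proof.
move=> t0; elim: n => [|n IHn]; first by rewrite mul0r addr0 expr0.
rewrite exprS; apply: le_trans (ler_wpM2l _ IHn); last by rewrite addr_ge0.
have : 0 <= n%:R * t * t by rewrite !mulr_ge0.
rewrite -natr1; nra.
Qed.

Lemma expr_unbounded t c : 1 < t -> exists n, c < t ^+ n.
Proof.
move=> t1; have t0 : 0 < t - 1 by rewrite subr_gt0.
have [n cn] : exists n : nat, c / (t - 1) < n%:R.
  by exists (Num.bound `|c / (t - 1)|); apply: le_lt_trans (ler_norm _) (archi_boundP _).
exists n; rewrite -[t](subrK 1) [_ - 1 + 1]addrC.
apply: lt_le_trans (bernoulli_ge n (ltW t0)).
by move: cn; rewrite ltr_pdivrMr //; lra.
Qed.

Lemma expr_small t c : 0 <= t < 1 -> 0 < c ->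
  exists k, forall n, (k <= n)%N -> t ^+ n < c.
Proof.
move=> /andP[t0 t1] c0; have [t00|tn0] := eqVneq t 0.
  by exists 1%N => -[//|n] _; rewrite t00 expr0n.
have tp : 0 < t by rewrite lt_def tn0.
have [|k kP] := @expr_unbounded t^-1 c^-1; first by rewrite invf_gt1.
exists k => n kn; apply: le_lt_trans (ler_wiXn2l t0 (ltW t1) kn) _.
by move: kP; rewrite exprVn ltf_pV2 ?posrE ?exprn_gt0.
Qed.

(** Lets one discard a factor that grows linearly with the exponent: the usual
    tensor-power device, used below both for |n| <= 1 and for the ultrametric
    inequality. *)
Lemma le1_of_expr_linear t c :
  0 <= t -> (forall n, t ^+ n <= c * n.+1%:R) -> t <= 1.
Proof.
move=> t0 tn; rewrite leNgt; apply/negP => t1.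
have h0 : 0 < t - 1 by rewrite subr_gt0.
set h := t - 1 in h0.
have [n cn] : exists n : nat, 3 * c / h ^+ 2 < n%:R.
  by exists (Num.bound `|3 * c / h ^+ 2|); apply: le_lt_trans (ler_norm _) (archi_boundP _).
(* An even exponent is taken since Bernoulli's bound must be squared to beat
   linear growth. *)
have := tn (n * 2)%N; rewrite exprM.
have bn : 1 + n%:R * h <= t ^+ n.
  by rewrite -[t](subrK 1) [_ - 1 + 1]addrC; exact: bernoulli_ge (ltW h0).
have := tn 0%N; rewrite expr0 mulr1 => c1.
move: cn; rewrite ltr_pdivrMr ?exprn_gt0 // => cn le.
have n0 : 0 <= n%:R :> R by [].
have : (1 + n%:R * h) ^+ 2 <= (t ^+ n) ^+ 2.
  by rewrite lerXn2r ?nnegrE ?addr_ge0 ?mulr_ge0 ?exprn_ge0 // ltW.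
move: le; rewrite -natr1 natrM => le.
have nh : 0 <= n%:R * h by rewrite mulr_ge0 // ltW.
have : 3 * c * n%:R <= n%:R * h ^+ 2 * n%:R by rewrite ler_wpM2r // ltW.
have n1 : 1 <= n%:R :> R.
  rewrite ler1n lt0n; apply/eqP => n00; move: cn; rewrite n00 mul0r; lra.
have : c <= c * n%:R by rewrite ler_peMr //; lra.
nra.
Qed.

Lemma sum_ord_le n (F : 'I_n -> R) c :
  (forall i, F i <= c) -> \sum_(i < n) F i <= c * n%:R.
Proof.
move=> Fc; rewrite mulr_natr -[in leRHS](card_ord n) -sumr_const.
by apply: ler_sum => i _.
Qed.

Lemma geometric_sum_le t k : 1 < t -> \sum_(i < k) t ^+ i <= t ^+ k / (t - 1).
Proof.
by move=> t1; rewrite ler_pdivlMr ?subr_gt0 // mulrC -subrX1 gerBl.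
Qed.

Lemma geometric_tail_le t K n : 0 <= t < 1 ->
  \sum_(i < n | (K <= i)%N) t ^+ i <= t ^+ K / (1 - t).
Proof.
move=> /andP[t0 t1]; have h0 : 0 < 1 - t by rewrite subr_gt0.
have [nK|Kn] := leqP n K.
  rewrite big1 ?divr_ge0 ?exprn_ge0 // ?ltW // => i.
  by have := ltn_ord i; lia.
rewrite -(big_mkord (fun i => (K <= i)%N)) (big_cat_nat (n := K)) ?(ltnW Kn) //=.
rewrite big_nat_cond big1 ?add0r; last by move=> i; lia.
rewrite -(subnK (ltnW Kn)) -{1}[K]add0n big_addn addnK big_mkord.
under eq_bigl do rewrite leq_addl.
under eq_bigr do rewrite exprD mulrC.
rewrite -mulr_sumr ler_wpM2l ?exprn_ge0 // -[leRHS]mul1r ler_pdivlMr //.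
by rewrite mulrC -opprB mulNr -subrX1 opprB gerBl exprn_ge0.
Qed.

End RealSequences.

(** * Absolute values of integers and the dichotomy on 2 *)

Section AbsoluteValue.
Context (R : realType) (C : fieldType) (v : absval R C).

Lemma absval0 : v 0 = 0. Proof. exact/absval_eq0. Qed.

Lemma absvalX x n : v (x ^+ n) = v x ^+ n.
Proof.
elim: n => [|n IHn]; first by rewrite !expr0 absval1.
by rewrite !exprS absvalM IHn.
Qed.

Lemma absvalV x : v x^-1 = (v x)^-1.
Proof.
have [->|x0] := eqVneq x 0; first by rewrite invr0 absval0 invr0.
have vx0 : v x != 0 by apply: contra x0 => /eqP/absval_eq0/eqP.
by apply: (mulfI vx0); rewrite -absvalM !divff // absval1.
Qed.

Lemma absval_distC x y : v (x - y) = v (y - x).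
Proof. by rewrite -absvalN opprB. Qed.

Lemma absval_sum (I : Type) (s : seq I) (P : pred I) (F : I -> C) :
  v (\sum_(i <- s | P i) F i) <= \sum_(i <- s | P i) v (F i).
Proof.
elim/big_ind2 : _ => [|x x' y y' lex ley|//]; first by rewrite absval0.
by apply: le_trans (absvalD _ _ _) _; rewrite lerD.
Qed.

(** Writing m i = odd (m i) + 2 (m i)./2 peels off one binary digit at a time;
    the sum weighted by a fixed digit is a plain subsum, bounded by e.  The bound
    does not depend on the number of terms. *)
Lemma absval_digits (I : Type) (s : seq I) (a : I -> C) (e : R) :
  (forall P : pred I, v (\sum_(i <- s | P i) a i) <= e) ->
  forall (k : nat) (m : I -> nat), (forall i, (m i < 2 ^ k)%N) ->
  v (\sum_(i <- s) (m i)%:R * a i) <= e * \sum_(j < k) v 2 ^+ j.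
Proof.
move=> ae; elim=> [|k IHk] m mk.
  rewrite big_ord0 mulr0 big1 ?absval0 // => i _.
  by move: (mk i); rewrite expn0 ltnS leqn0 => /eqP ->; rewrite mul0r.
have -> : \sum_(i <- s) (m i)%:R * a i =
    \sum_(i <- s | odd (m i)) a i + 2 * \sum_(i <- s) (m i)./2%:R * a i.
  rewrite mulr_sumr [X in _ = X + _]big_mkcond -big_split /=.
  apply: eq_bigr => i _; rewrite -{1}[m i]odd_double_half natrD -muln2 natrM.
  by case: (odd _); rewrite /= ?mul0r; ring.
apply: le_trans (absvalD _ _ _) _; rewrite big_ord_recl expr0 mulrDr mulr1.
apply: lerD; first exact: ae.
under [X in _ <= e * X]eq_bigr do rewrite lift0 exprS.
rewrite -mulr_sumr mulrCA absvalM ler_wpM2l ?absval_ge0 //.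
by apply: IHk => i; have := mk i; rewrite expnS; lia.
Qed.

Lemma absval_nat_digits n k : (n < 2 ^ k)%N -> v n%:R <= \sum_(j < k) v 2 ^+ j.
Proof.
move=> nk; have := @absval_digits unit [:: tt] (fun=> 1) 1 _ k (fun=> n) (fun=> nk).
rewrite big_seq1 mulr1 mul1r; apply => P; rewrite big_mkcond big_seq1.
by case: ifP; rewrite ?absval1 ?absval0.
Qed.

(** n^N has O(N) binary digits, each contributing at most 1 as |2| <= 1, so that
    |n|^N grows at most linearly in N. *)
Lemma absval_nat_le1 n : v 2 <= 1 -> v n%:R <= 1.
Proof.
move=> v2; apply: (@le1_of_expr_linear _ _ n.+1%:R); first exact: absval_ge0.
move=> N; rewrite -absvalX -natrX.
have nN : (n ^ N < 2 ^ (n.+1 * N.+1))%N.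
  rewrite (leq_ltn_trans (n := (2 ^ n.+1) ^ N)) //.
    case: (N) => [|N'] //; rewrite leq_exp2r // ltnW //.
    by rewrite (ltn_trans (ltn_expl n (ltnSn 1))) // ltn_exp2l.
  by rewrite -expnM ltn_exp2l //; lia.
apply: le_trans (absval_nat_digits nN) _.
rewrite -natrM -[leRHS]mul1r.
by apply: sum_ord_le => i; rewrite exprn_ile1 ?absval_ge0.
Qed.

(** In the binomial expansion of (x + y)^N all coefficients have absolute value
    at most 1, so that |x + y|^N <= (N + 1) e^N. *)
Lemma absval_ultra x y e : v 2 <= 1 -> v x <= e -> v y <= e -> v (x + y) <= e.
Proof.
move=> v2 xe ye; have e0 : 0 <= e := le_trans (absval_ge0 _ _) xe.
have [e00|en0] := eqVneq e 0.
  move: xe ye; rewrite e00 => xe ye.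
  by apply: le_trans (absvalD _ _ _) _; rewrite -[0]addr0 lerD.
have ep : 0 < e by rewrite lt_def en0.
rewrite -[leRHS]mul1r -ler_pdivrMr //.
apply: (@le1_of_expr_linear _ _ 1); first by rewrite divr_ge0 ?absval_ge0.
move=> N; rewrite expr_div_n ler_pdivrMr ?exprn_gt0 // -absvalX exprDn mul1r.
apply: le_trans (absval_sum _ _ _) _.
rewrite mulrC; apply: sum_ord_le => -[i /= iN]; rewrite -mulr_natl absvalM -[leRHS]mul1r.
apply: ler_pM; rewrite ?absval_ge0 //; first exact: absval_nat_le1.
rewrite absvalM !absvalX -[in leRHS](@subnK i N) // exprD.
by rewrite ler_pM ?exprn_ge0 ?absval_ge0 // lerXn2r ?nnegrE ?absval_ge0.
Qed.

Lemma absval_sum_ultra (I : Type) (s : seq I) (P : pred I) (F : I -> C) e :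
  v 2 <= 1 -> 0 <= e -> (forall i, P i -> v (F i) <= e) ->
  v (\sum_(i <- s | P i) F i) <= e.
Proof.
move=> v2 e0 Fe; apply: (big_ind (fun z => v z <= e)) => //.
  by rewrite absval0.
by move=> x y; exact: absval_ultra.
Qed.

(** This is the part of Ostrowski's theorem that the damping needs.  Since
    m = 2^k - 1 is smaller than 2^k, a large power m^N has j binary digits fewer
    than 2^(kN); hence |m|^N is at most |2|^(kN - j) / (|2| - 1), which is smaller
    than |2|^(kN) once |2|^j exceeds 1 / (|2| - 1). *)
Lemma absval_mersenne k : 1 < v 2 -> v (2 ^ k - 1)%N%:R < v 2 ^+ k.
Proof.
move=> v2; have v20 : 0 < v 2 by apply: lt_trans v2.
rewrite ltNge; apply/negP => le.
set m := (2 ^ k - 1)%N in le *.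
have mE : (2 ^ k = m.+1)%N by rewrite /m subn1 prednK ?expn_gt0.
have m0 : (0 < m)%N.
  rewrite lt0n; apply/eqP => m00; move: le.
  by rewrite m00 absval0 leNgt exprn_gt0.
have [j jP] := expr_unbounded (v 2 - 1)^-1 v2.
(* Bernoulli: (1 + 1/m)^N >= 1 + N/m, which is 1 + 2^j for this N. *)
pose N := (m * 2 ^ j)%N.
have mN : (m ^ N * 2 ^ j < 2 ^ (k * N))%N.
  have bern n : ((m + n) * m ^ n <= m * m.+1 ^ n)%N.
    elim: n => [|n IHn]; first by rewrite addn0.
    rewrite !expnS [leqRHS]mulnCA (leq_trans _ (leq_mul (leqnn m.+1) IHn)) //.
    rewrite !mulnA leq_mul2r; apply/orP; right; nia.
  have := bern N; rewrite expnM mE /N -mulnS -mulnA leq_pmul2l // mulSn -/N.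
  by apply: leq_trans; rewrite mulnC -addn1 addnC leq_add2r expn_gt0 m0.
have jN : (j < k * N)%N.
  rewrite -(@ltn_exp2l 2) //; apply: leq_ltn_trans mN.
  by rewrite leq_pmull // expn_gt0 m0.
have mN' : (m ^ N < 2 ^ (k * N - j))%N.
  by rewrite -(@ltn_pmul2r (2 ^ j)) ?expn_gt0 // -expnD subnK // ltnW.
have := le_trans (absval_nat_digits mN') (geometric_sum_le _ v2).
rewrite natrX absvalX => le2.
have le3 : (v 2 ^+ k) ^+ N <= v m%:R ^+ N.
  by rewrite lerXn2r ?nnegrE ?exprn_ge0 ?absval_ge0.
have := le_trans le3 le2; rewrite -exprM -{1}(subnK (ltnW jN)) exprD.
by rewrite ler_pM2l ?exprn_gt0 // leNgt jP.
Qed.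

End AbsoluteValue.

(** * Unconditional convergence bounds the subsums of tails *)

Section Rearrangement.

(** Reorderings of consecutive finite blocks glue, because every number lies in
    exactly one block: both s and its inverse first locate the block. *)
Lemma block_rearrangement (st : nat -> nat) (L : nat -> seq nat) :
  st 0 = 0%N -> (forall i, st i < st i.+1)%N ->
  (forall i, perm_eq (L i) (index_iota (st i) (st i.+1))) ->
  exists2 s : nat -> nat, bijective s &
    forall i, [seq s n | n <- index_iota (st i) (st i.+1)] = L i.
Proof.
move=> st0 stS Lp.
have mono i j : (i <= j)%N -> (st i <= st j)%N.
  by move=> ij; apply: (homo_leq leqnn leq_trans) ij => k; exact: ltnW.
have blkP n : exists i, (st i <= n < st i.+1)%N.
  elim: n => [|n [i /andP[i1 i2]]].
    by exists 0%N; rewrite st0 /=; apply: leq_ltn_trans (stS 0%N).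
  have [ni|ni] := ltnP n.+1 (st i.+1); first by exists i; rewrite ni leqW.
  by exists i.+1; rewrite ni (leq_ltn_trans i2) ?stS.
have [blk blkE] := choice blkP.
have blk_eq n i : (st i <= n < st i.+1)%N -> blk n = i.
  move=> /andP[i1 i2]; have /andP[b1 b2] := blkE n.
  apply/eqP; rewrite eqn_leq; apply/andP; split; rewrite leqNgt; apply/negP => /mono; lia.
have memL i n : (n \in L i) = (st i <= n < st i.+1)%N.
  by rewrite (perm_mem (Lp i)) mem_index_iota.
have sizeL i : size (L i) = (st i.+1 - st i)%N.
  by rewrite (perm_size (Lp i)) size_iota.
have uniqL i : uniq (L i) by rewrite (perm_uniq (Lp i)) iota_uniq.
pose s n := nth 0%N (L (blk n)) (n - st (blk n)).
pose t n := (st (blk n) + index n (L (blk n)))%N.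
have sP n : (st (blk n) <= s n < st (blk n).+1)%N.
  by rewrite -memL mem_nth // sizeL; have := blkE n; lia.
have tP n : (st (blk n) <= t n < st (blk n).+1)%N.
  have : (index n (L (blk n)) < size (L (blk n)))%N by rewrite index_mem memL.
  by rewrite sizeL /t; lia.
exists s.
  exists t => n.
    rewrite /t (blk_eq _ _ (sP n)) /s index_uniq // ?sizeL; have := blkE n; lia.
  rewrite /s (blk_eq _ _ (tP n)) /t addKn nth_index // memL.
  exact: blkE.
move=> i; apply: (@eq_from_nth _ 0%N); first by rewrite size_map size_iota sizeL.
move=> j; rewrite size_map size_iota => ji.
rewrite (nth_map 0%N) ?size_iota // nth_iota //.
by rewrite /s (blk_eq _ i) ?addKn //; lia.
Qed.

Context (R : realType) (C : fieldType) (v : absval R C).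
Variables (a : nat -> C) (l : C).
Hypothesis al : unconditional_cvg v a l.

(** Otherwise there are disjoint consecutive blocks each containing a subset
    whose sum exceeds e.  Rearranging every block so that this subset comes first
    makes the partial sums jump by more than e again and again, so that the
    rearranged series is not Cauchy. *)
Lemma unconditional_tail (e : R) : 0 < e ->
  exists N0, forall N (P : pred nat), v (\sum_(N0 <= i < N | P i) a i) <= e.
Proof.
move=> e0; apply: contrapT => /forallNP noN0.
have {}noN0 N0 : exists NP : nat * pred nat, e < v (\sum_(N0 <= i < NP.1 | NP.2 i) a i).
  have /existsNP[N /existsNP[P /negP]] := noN0 N0.
  by rewrite -ltNge => NP; exists (N, P).
have [g gP] := choice noN0.
pose st i := iter i (fun n => (g n).1) 0%N.
have stS i : (st i < st i.+1)%N.
  rewrite ltnNge; apply/negP => le; have := gP (st i).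
  by rewrite big_geq // absval0; lra.
pose P i := (g (st i)).2.
pose L i := [seq n <- index_iota (st i) (st i.+1) | P i n] ++
            [seq n <- index_iota (st i) (st i.+1) | predC (P i) n].
have [|s sbij sL] := @block_rearrangement st L erefl stS.
  by move=> i; rewrite /L; apply/permPl; exact: perm_filterC.
have st_ge i : (i <= st i)%N.
  by elim: i => // i IHi; apply: leq_ltn_trans (stS i).
have e2 : 0 < e / 2 by rewrite divr_gt0.
have cvg_s : series_cvg v (a \o s) l := @al s sbij.
have [N NP] := (series_cvgP _ _ _).1 cvg_s _ e2.
pose c := count (P N) (index_iota (st N) (st N.+1)).
have cle : (c <= st N.+1 - st N)%N by rewrite (leq_trans (count_size _ _)) ?size_iota.
have blockE : \sum_(st N <= k < st N + c) a (s k) =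
    \sum_(st N <= i < st N.+1 | P N i) a i.
  rewrite -(big_map s xpredT a) -[RHS]big_filter; congr (\sum_(i <- _) _).
  have -> : index_iota (st N) (st N + c) = take c (index_iota (st N) (st N.+1)).
    by rewrite /index_iota take_iota addKn (minn_idPl cle).
  by rewrite map_take sL /L take_size_cat // size_filter.
have := gP (st N); rewrite -blockE.
have := NP (st N) (st_ge N).
have := NP (st N + c)%N (leq_trans (st_ge N) (leq_addr _ _)).
rewrite (big_cat_nat (n := st N)) ?leq_addr //=.
set S1 := \sum_(0 <= _ < _) _; set S2 := \sum_(_ <= _ < _) _.
move=> h1 h2; have := absvalD v (S1 + S2 - l) (l - S1).
rewrite (absval_distC _ l S1).
have -> : S1 + S2 - l + (l - S1) = S2 by ring.
lra.
Qed.

Lemma unconditional_term (e : R) : 0 < e ->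
  exists N0, forall n, (N0 <= n)%N -> v (a n) <= e.
Proof.
move=> /unconditional_tail[N0 N0P]; exists N0 => n Nn.
have := N0P n.+1 (leq n); rewrite big_mkcond big_nat_recr //= leqnn big1_seq ?add0r //.
by move=> i; rewrite mem_index_iota => /andP[_ /andP[_ i_n]]; rewrite leqNgt i_n.
Qed.

Lemma unconditional_bounded : exists M : R, 0 <= M /\ forall n, v (a n) <= M.
Proof.
have [N0 N0P] := unconditional_term ltr01.
exists (1 + \sum_(i < N0) v (a i)).
have s0 (Q : pred 'I_N0) : 0 <= \sum_(i < N0 | Q i) v (a i).
  by apply: sumr_ge0 => i _; exact: absval_ge0.
split=> [|n]; first by rewrite addr_ge0.
have [nN|Nn] := ltnP n N0; last by rewrite (le_trans (N0P n Nn)) // lerDl.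
by rewrite (bigD1 (Ordinal nN)) //= addrCA lerDl addr_ge0.
Qed.

Lemma unconditional_sum (e : R) : 0 < e ->
  exists N0, forall N, (N0 <= N)%N -> v (\sum_(0 <= i < N) a i - l) < e.
Proof.
move=> e0; have idb : bijective (@id nat) by exists id.
have cvg_id : series_cvg v (a \o id) l := @al id idb.
exact: ((series_cvgP _ _ _).1 cvg_id _ e0).
Qed.

End Rearrangement.

(** * Norms on polynomials and the truncated cubic *)

Section PolyNorms.
Context (R : realType) (C : fieldType) (v : absval R C).

(** A submultiplicative norm on polynomials that controls evaluation at y and
    decreases under truncation.  It is given by the relation norm_le p e, for
    the norm of p being at most e, so that suprema need not be formed.  This
    interface covers both the Gauss norm and the sum of the absolute values of
    the terms at y. *)
Record poly_norm (y : C) := PolyNorm {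
  norm_le :> {poly C} -> R -> Prop ;
  norm_leC : forall c, norm_le c%:P (v c) ;
  norm_leX : norm_le 'X (v y) ;
  norm_leD : forall p q d e, norm_le p d -> norm_le q e -> norm_le (p + q) (d + e) ;
  norm_leM : forall p q d e, norm_le p d -> norm_le q e -> norm_le (p * q) (d * e) ;
  norm_le_trans : forall p d e, norm_le p d -> d <= e -> norm_le p e ;
  norm_le_trunc : forall n (p q : {poly C}) e, (forall i, (i < n)%N -> p`_i = q`_i) ->
    (size p <= n)%N -> norm_le q e -> norm_le p e ;
  norm_le_horner : forall p e, norm_le p e -> v p.[y] <= e }.

(** Let G_K be the cubic expression in the K-th truncation of E_0.  It has degree
    below 3K, while G_(3K) vanishes modulo X^(3K); so G_K is the truncation of
    G_K - G_(3K).  The latter is divisible by the difference of the two truncations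
    of E_0, which is small. *)
Lemma cubic_truncation_cvg (y : C) (nrm : poly_norm y) (M : R) :
  (forall K, nrm (bin3_poly C K 0) M) ->
  (forall d, 0 < d -> exists K0, forall K, (K0 <= K)%N ->
     nrm (bin3_poly C K 0 - bin3_poly C (3 * K) 0) d) ->
  forall e, 0 < e -> exists K0, forall K, (K0 <= K)%N ->
    v (cubic y (bin3_poly C K 0).[y]) <= e.
Proof.
move=> EM Ed e e0.
pose W := v 27%:R * v y + v (- 4%:R).
have M0 : 0 <= M := le_trans (absval_ge0 _ _) (norm_le_horner (EM 0%N)).
have W0 : 0 <= W by rewrite addr_ge0 ?mulr_ge0 ?absval_ge0.
pose c := W * (M * M + M * M + M * M) + v 3%:R.
have c0 : 0 <= c by rewrite addr_ge0 ?mulr_ge0 ?addr_ge0 ?mulr_ge0 ?absval_ge0.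
have [|K0 K0P] := Ed (e / (c + 1)); first by rewrite divr_gt0 // ltr_wpDl.
exists K0.+1 => K KK0; rewrite -horner_cubic_poly; apply: (@norm_le_horner _ nrm).
have {K0P} Rd := K0P K (ltnW KK0).
apply: (@norm_le_trunc _ nrm (3 * K) _ (cubic_poly C K - cubic_poly C (3 * K))).
- by move=> i iK; rewrite coefB ((dvdXnP _ _ (dvdXn_cubic_poly C (3 * K))) i iK) subr0.
- by apply: size_cubic_poly; lia.
set E1 := bin3_poly C K 0 in Rd *; set E3 := bin3_poly C (3 * K) 0 in Rd *.
have -> : cubic_poly C K - cubic_poly C (3 * K) =
    (27%:R%:P * 'X + (- 4%:R)%:P) * ((E1 - E3) * (E1 * E1 + E1 * E3 + E3 * E3))
    + 3%:R%:P * (E1 - E3).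
  by rewrite /cubic_poly -/E1 -/E3 -!mul_polyC polyCN; ring.
apply: norm_le_trans.
  apply: norm_leD; apply: norm_leM; first 1 last.
  - by apply: norm_leM; [exact: Rd|apply: norm_leD; [apply: norm_leD|]; apply: norm_leM; exact: EM].
  - exact: norm_leC.
  - exact: Rd.
  - by apply: norm_leD; [apply: norm_leM; [exact: norm_leC|exact: norm_leX]|exact: norm_leC].
rewrite -/W [v 3%:R * _]mulrC mulrCA -mulrDr -/c mulrAC ler_pdivrMr ?ltr_wpDl //.
by rewrite ler_wpM2l // ?lerDl // ltW.
Qed.

(** The Gauss norm max_i |p_i y^i|; the ultrametric inequality makes it
    submultiplicative and lets it control the value at y. *)
Lemma gauss_norm (y : C) : v 2 <= 1 ->
  {nrm : poly_norm y | forall p e, nrm p e <-> forall i, v (p`_i * y ^+ i) <= e}.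
Proof.
move=> v2.
unshelve eexists (@PolyNorm y (fun p e => forall i, v (p`_i * y ^+ i) <= e) _ _ _ _ _ _ _) => //.
- move=> c i; rewrite coefC; case: eqP => [->|_]; first by rewrite expr0 mulr1.
  by rewrite mul0r absval0 absval_ge0.
- move=> i; rewrite coefX; case: eqP => [->|_]; first by rewrite mul1r expr1.
  by rewrite mul0r absval0 absval_ge0.
- move=> p q d e pd qe i; rewrite coefD mulrDl.
  have d0 := le_trans (absval_ge0 _ _) (pd 0%N).
  have e0 := le_trans (absval_ge0 _ _) (qe 0%N).
  by apply: absval_ultra => //; [apply: le_trans (pd i) _|apply: le_trans (qe i) _];
    rewrite ?lerDl ?lerDr.
- move=> p q d e pd qe i; rewrite coefM mulr_suml.
  have d0 := le_trans (absval_ge0 _ _) (pd 0%N).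
  have e0 := le_trans (absval_ge0 _ _) (qe 0%N).
  apply: absval_sum_ultra => // [|j _]; first by rewrite mulr_ge0.
  have ji : (j <= i)%N by rewrite -ltnS.
  have -> : y ^+ i = y ^+ j * y ^+ (i - j) by rewrite -exprD subnKC.
  by rewrite mulrACA absvalM ler_pM ?absval_ge0.
- by move=> p d e pd de i; exact: le_trans (pd i) de.
- move=> n p q e pq pn qe i; have [iN|ni] := ltnP i n; first by rewrite pq.
  by rewrite nth_default ?(leq_trans pn) // mul0r absval0 (le_trans (absval_ge0 _ _) (qe 0%N)).
- move=> p e pe; rewrite horner_coef; apply: absval_sum_ultra => //.
  exact: le_trans (absval_ge0 _ _) (pe 0%N).
Qed.

(** The norm sum_i |p_i y^i|.  For submultiplicativity, the terms of p q of degree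
    below n come from the index pairs in a triangle, which lies in the square
    over which the product of the two sums extends. *)
Lemma sum_norm (y : C) :
  {nrm : poly_norm y |
    forall p e, nrm p e <-> forall n, \sum_(i < n) v (p`_i * y ^+ i) <= e}.
Proof.
unshelve eexists (@PolyNorm y
  (fun p e => forall n, \sum_(i < n) v (p`_i * y ^+ i) <= e) _ _ _ _ _ _ _) => //.
- move=> c [|n]; first by rewrite big_ord0 absval_ge0.
  rewrite big_ord_recl big1 ?addr0 => [|i _]; first by rewrite coefC expr0 mulr1.
  by rewrite coefC mul0r absval0.
- move=> [|[|n]]; rewrite ?big_ord0 ?absval_ge0 //.
    by rewrite big_ord1 coefX mul0r absval0 absval_ge0.
  rewrite !big_ord_recl big1 ?addr0 => [|i _].
    by rewrite !coefX mul0r absval0 add0r mul1r expr1.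
  by rewrite coefX mul0r absval0.
- move=> p q d e pd qe n; apply: le_trans (lerD (pd n) (qe n)).
  by rewrite -big_split ler_sum // => i _; rewrite coefD mulrDl absvalD.
- move=> p q d e pd qe n; apply: le_trans (ler_pM _ _ (pd n) (qe n)); last 2 first.
  + by apply: sumr_ge0 => i _; exact: absval_ge0.
  + by apply: sumr_ge0 => i _; exact: absval_ge0.
  pose u i := v (p`_i * y ^+ i); pose w i := v (q`_i * y ^+ i).
  have w0 i : 0 <= w i by exact: absval_ge0.
  apply: (@le_trans _ _ (\sum_(m < n) \sum_(i < n | (i < m.+1)%N) u i * w (m - i)%N)).
    apply: ler_sum => m _; rewrite coefM mulr_suml; apply: le_trans (absval_sum _ _ _ _) _.
    rewrite (big_ord_widen n (fun i => v (p`_i * q`_(m - i) * y ^+ m))) //.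
    apply: ler_sum => i im; rewrite -absvalM.
    have -> : y ^+ m = y ^+ i * y ^+ (m - i) by rewrite -exprD subnKC.
    by rewrite mulrACA.
  rewrite (exchange_big_dep xpredT) //= mulr_suml; apply: ler_sum => i _.
  rewrite -mulr_sumr ler_wpM2l ?absval_ge0 //.
  rewrite -(big_mkord (fun m => (i < m.+1)%N) (fun m => w (m - i)%N)).
  rewrite (big_cat_nat (n := i)) ?(ltnW (ltn_ord i)) //=.
  rewrite big_nat_cond big1 ?add0r; last by move=> m; lia.
  rewrite -[X in \sum_(X <= _ < _ | _) _]add0n big_addn big_mkord.
  under [leLHS]eq_bigl do rewrite ltnS leq_addl.
  under [leLHS]eq_bigr do rewrite addnK.
  rewrite -(big_mkord xpredT w) -[leRHS](big_mkord xpredT w).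
  by rewrite [leRHS](big_cat_nat (n := (n - i)%N)) ?leq_subr //= lerDl sumr_ge0.
- by move=> p d e pd de n; exact: le_trans (pd n) de.
- move=> n p q e pq pn qe k; apply: le_trans (qe k); apply: ler_sum => i _.
  have [iN|ni] := ltnP i n; first by rewrite pq.
  by rewrite nth_default ?(leq_trans pn) // mul0r absval0 absval_ge0.
- by move=> p e pe; rewrite horner_coef; apply: le_trans (absval_sum _ _ _ _) _.
Qed.

(** Continuity of the cubic, in the form in which limits are taken: x and l need
    only be approximated by points where the cubic is small. *)
Lemma cubic_closed (x l : C) :
  (forall e, 0 < e -> exists y b,
    [/\ v (y - x) <= e, v (b - l) <= e & v (cubic y b) <= e]) ->
  cubic x l = 0.
Proof.
move=> app; apply/eqP/negPn/negP => /eqP xl0.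
set g := v (cubic x l); have g0 : 0 < g.
  by rewrite lt_def absval_ge0 andbT; apply/eqP => /absval_eq0.
pose B := v l + 1.
pose c := 1 + v 27%:R * B ^+ 3 +
  v (27%:R * x - 4%:R) * (1 + v 3%:R * v l + v 3%:R * v l ^+ 2) + v 3%:R.
have l0 := absval_ge0 v l; have v3 := absval_ge0 v 3%:R; have v27 := absval_ge0 v 27%:R.
have vx := absval_ge0 v (27%:R * x - 4%:R).
have B0 : 0 <= B by rewrite addr_ge0.
have c0 : 0 < c.
  by rewrite !ltr_pwDl // ?mulr_ge0 ?addr_ge0 ?mulr_ge0 ?exprn_ge0.
have gc : 0 < g / (2 * c) by rewrite divr_gt0 // mulr_gt0.
pose e := Num.min 1 (g / (2 * c)).
have e0 : 0 < e by rewrite lt_min ltr01.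
have e1 : e <= 1 by rewrite ge_min lexx.
have [y [b [ye be ce]]] := app e e0.
(* Taylor expansion around (x, l) in the increments d and h. *)
pose d := y - x; pose h := b - l.
have E : cubic x l = cubic y b + - (27%:R * d * b ^+ 3) +
   - ((27%:R * x - 4%:R) * (h * (h ^+ 2 + 3%:R * h * l + 3%:R * l ^+ 2))) + - (3%:R * h).
  by rewrite /cubic /d /h; ring.
have bB : v b <= B.
  have -> : b = l + (b - l) by ring.
  by apply: le_trans (absvalD _ _ _) _; rewrite lerD2l (le_trans be).
have hi : v (h ^+ 2 + 3%:R * h * l + 3%:R * l ^+ 2) <= 1 + v 3%:R * v l + v 3%:R * v l ^+ 2.
  have h1 : v h <= 1 by exact: le_trans be e1.
  apply: le_trans (absvalD _ _ _) _; rewrite absvalM absvalX lerD2r.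
  apply: le_trans (absvalD _ _ _) _; rewrite absvalX !absvalM lerD //.
    by rewrite exprn_ile1 ?absval_ge0.
  by rewrite ler_wpM2r // ler_piMr.
have : g <= e * c.
  have -> : e * c = e + e * (v 27%:R * B ^+ 3) +
     e * (v (27%:R * x - 4%:R) * (1 + v 3%:R * v l + v 3%:R * v l ^+ 2)) + e * v 3%:R.
    by rewrite /c; ring.
  rewrite /g E.
  apply: le_trans (absvalD _ _ _) _; apply: lerD; last first.
    by rewrite absvalN absvalM mulrC ler_wpM2r.
  apply: le_trans (absvalD _ _ _) _; apply: lerD; last first.
    rewrite absvalN !absvalM mulrCA.
    by rewrite ler_pM ?mulr_ge0 ?absval_ge0 // ler_wpM2l.
  apply: le_trans (absvalD _ _ _) _; apply: lerD => //.
  rewrite absvalN absvalM absvalX absvalM -mulrA mulrCA.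
  by rewrite ler_pM ?mulr_ge0 ?exprn_ge0 ?absval_ge0 // ler_wpM2l // lerXn2r ?nnegrE ?absval_ge0.
have : e * c <= g / 2.
  have -> : g / 2 = g / (2 * c) * c by field; rewrite gt_eqF.
  by rewrite ler_wpM2r ?(ltW c0) // ge_min lexx orbT.
lra.
Qed.

End PolyNorms.

(** * Damping a series when 2 has absolute value above 1 *)

Section Damping.
Context (R : realType) (C : fieldType) (v : absval R C).
Hypothesis v2 : 1 < v 2.

(** This is 1 - 2^-k; as a fraction of integers it gives its powers dyadic
    numerators to which binary expansion applies. *)
Definition damping (k : nat) : C := (2 ^ k - 1)%N%:R / 2 ^+ k.

Let two_neq0 : (2 : C) != 0.
Proof. by apply/eqP => t0; move: v2; rewrite t0 absval0 ltNge ler01. Qed.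

Lemma absval_damping k : v (damping k) < 1.
Proof.
rewrite absvalM absvalV absvalX ltr_pdivrMr ?exprn_gt0 ?(lt_trans ltr01) //.
by rewrite mul1r absval_mersenne.
Qed.

Lemma absval_dampingB1 k : v (damping k - 1) = (v 2)^-1 ^+ k.
Proof.
have -> : damping k - 1 = - (2^-1) ^+ k.
  rewrite /damping natrB ?expn_gt0 // natrX exprVn; field; exact: expf_neq0.
by rewrite absvalN absvalX absvalV.
Qed.

Lemma absval_dampingXB1 k i : v (damping k ^+ i - 1) <= i%:R * (v 2)^-1 ^+ k.
Proof.
elim: i => [|i IHi]; first by rewrite expr0 subrr absval0 mul0r.
have -> : damping k ^+ i.+1 - 1 = damping k * (damping k ^+ i - 1) + (damping k - 1).
  by rewrite exprS; ring.
apply: le_trans (absvalD _ _ _) _; rewrite absval_dampingB1 -[i.+1%:R]natr1 mulrDl mul1r lerD2r.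
by rewrite absvalM (le_trans _ IHi) // ler_piMl ?absval_ge0 // ltW ?absval_damping.
Qed.

(** Over the common denominator 2^(kN) the weights have numerators in
    [0, 2^(kN)], hence at most kN + 1 binary digits; the geometric sum of the
    powers of |2| is absorbed by the denominator, and the bound is uniform in k
    and N. *)
Lemma damped_block (a : nat -> C) (d : R) (N0 N k : nat) :
  (forall P : pred nat, v (\sum_(N0 <= i < N | P i) a i) <= d) ->
  v (\sum_(N0 <= i < N) a i * damping k ^+ i) <= d * (v 2 / (v 2 - 1)).
Proof.
move=> ad; have d0 : 0 <= d := le_trans (absval_ge0 _ _) (ad xpredT).
have v20 : 0 < v 2 := lt_trans ltr01 v2.
pose m i := if (i < N)%N then ((2 ^ k - 1) ^ i * 2 ^ (k * (N - i)))%N else 0%N.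
have mE i : (i < N)%N -> a i * damping k ^+ i = (2 ^+ (k * N))^-1 * ((m i)%:R * a i).
  move=> iN; rewrite /m iN /damping natrM !natrX expr_div_n -exprM.
  have -> : 2 ^+ (k * N) = 2 ^+ (k * i) * 2 ^+ (k * (N - i)) :> C.
    by rewrite -exprD -mulnDr subnKC // ltnW.
  by field; rewrite !expf_neq0.
rewrite (eq_big_nat _ _ (F2 := fun i => (2 ^+ (k * N))^-1 * ((m i)%:R * a i))); last first.
  by move=> i /andP[_ iN]; exact: mE.
rewrite -mulr_sumr absvalM absvalV absvalX mulrC ler_pdivrMr ?exprn_gt0 //.
have mlt i : (m i < 2 ^ (k * N).+1)%N.
  rewrite /m; case: ifP => [iN|_]; last by rewrite expn_gt0.
  rewrite (@leq_ltn_trans (2 ^ (k * N))) ?ltn_exp2l //.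
  rewrite -[in leqRHS](subnKC (ltnW iN)) mulnDr expnD leq_mul2r (expnM 2 k i).
  by apply/orP; right; case: (i) => [//|j]; rewrite leq_exp2r // leq_subr.
apply: le_trans (absval_digits ad mlt) _.
rewrite -mulrA ler_wpM2l //; apply: le_trans (geometric_sum_le _ v2) _.
by rewrite exprS mulrAC.
Qed.

(** The substitute for Abel's theorem.  The head of the series tends to its
    undamped value as k grows, and the damped tail is small uniformly in k; thus
    N0 can be chosen independently of k, which allows k to be fixed first and
    the number of terms to grow afterwards. *)
Lemma damped_sum_cvg (a : nat -> C) (l : C) : unconditional_cvg v a l ->
  forall e, 0 < e -> exists k0 N0, forall k N, (k0 <= k)%N -> (N0 <= N)%N ->
    v (\sum_(i < N) a i * damping k ^+ i - l) <= e.
Proof.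
move=> al e e0; have v20 : 0 < v 2 := lt_trans ltr01 v2.
have q0 : 0 <= v 2 / (v 2 - 1) by rewrite divr_ge0 ?absval_ge0 // subr_ge0 ltW.
set q := v 2 / (v 2 - 1) in q0.
pose d := e / (3 + q).
have d0 : 0 < d by rewrite divr_gt0 // ltr_pwDl.
have [M [M0 aM]] := unconditional_bounded al.
have [N0 N0P] := unconditional_tail al d0.
have [N1 N1P] := unconditional_sum al d0.
have [||k0 k0P] := @expr_small _ (v 2)^-1 (d / (M * (N0%:R * N0%:R) + 1)).
- by rewrite invr_ge0 absval_ge0 invf_lt1.
- by rewrite divr_gt0 // ltr_wpDl // !mulr_ge0.
exists k0, N0 => k N kk NN.
have head : v (\sum_(0 <= i < N0) a i * (damping k ^+ i - 1)) <= d.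
  apply: le_trans (absval_sum _ _ _ _) _; rewrite big_mkord.
  apply: le_trans (sum_ord_le (c := M * (N0%:R * (v 2)^-1 ^+ k)) _) _.
    move=> i; rewrite absvalM ler_pM ?absval_ge0 //.
    apply: le_trans (absval_dampingXB1 _ _) _.
    rewrite ler_wpM2r ?exprn_ge0 ?invr_ge0 ?absval_ge0 //.
    by rewrite ler_nat ltnW.
  have := k0P k kk; rewrite ltr_pdivlMr; last by rewrite ltr_wpDl // !mulr_ge0.
  have : 0 <= (v 2)^-1 ^+ k by rewrite exprn_ge0 ?invr_ge0 ?absval_ge0.
  set t := _ ^+ k => t0; rewrite mulrDr mulr1 => /ltW; apply: le_trans.
  have -> : M * (N0%:R * t) * N0%:R = t * (M * (N0%:R * N0%:R)) by ring.
  by rewrite lerDl.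
have tail : v (\sum_(N0 <= i < N) a i * damping k ^+ i) <= d * q.
  exact/damped_block/N0P.
have lim : v (\sum_(0 <= i < N0) a i - l) <= d + d.
  pose N2 := maxn N0 N1.
  have := N1P N2 (leq_maxr _ _); rewrite (big_cat_nat (n := N0)) ?leq_maxl //=.
  have := N0P N2 xpredT.
  set S0 := \sum_(0 <= _ < _) _; set T := \sum_(_ <= _ < _) _ => Td Sl.
  have -> : S0 - l = (S0 + T - l) + (- T) by ring.
  by apply: le_trans (absvalD _ _ _) _; rewrite absvalN lerD // ltW.
rewrite -(big_mkord xpredT (fun i => a i * damping k ^+ i)) (big_cat_nat (n := N0)) //=.
set U := \sum_(N0 <= _ < _) _ in tail *.
have -> : \sum_(0 <= i < N0) a i * damping k ^+ i + U - l =
  \sum_(0 <= i < N0) a i * (damping k ^+ i - 1) + U + (\sum_(0 <= i < N0) a i - l).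
  under [in RHS]eq_bigr do rewrite mulrBr mulr1.
  by rewrite sumrB; ring.
have -> : e = d + d * q + (d + d).
  by rewrite /d; field; rewrite gt_eqF // ltr_pwDl.
apply: le_trans (absvalD _ _ _) _; apply: lerD => //.
by apply: le_trans (absvalD _ _ _) _; apply: lerD.
Qed.

End Damping.

(** * The sum of the series is a root of the cubic *)

Section Main.
Context (R : realType) (C : fieldType) (v : absval R C).
Variables (x l : C).
Hypothesis xl : unconditional_cvg v (fun n => (bin3 0 n)%:R * x ^+ n) l.

Lemma horner_bin3_poly K y : (bin3_poly C K 0).[y] = \sum_(i < K) (bin3 0 i)%:R * y ^+ i.
Proof. exact: horner_poly. Qed.

Lemma cubic_nonarchimedean : v 2 <= 1 -> cubic x l = 0.
Proof.
move=> v2; apply: (cubic_closed (v := v)) => e e0.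
have [nrm nrmP] := gauss_norm x v2.
have [M [M0 aM]] := unconditional_bounded xl.
have [||K0 K0P] := @cubic_truncation_cvg _ _ _ _ nrm M _ _ e e0.
- move=> K; apply/nrmP => i; rewrite coef_poly; case: ifP => _; first exact: aM.
  by rewrite mul0r absval0.
- move=> d d0; have [N0 N0P] := unconditional_term xl d0.
  exists N0 => K NK; apply/nrmP => i; rewrite coefB !coef_poly.
  have [iK|Ki] := ltnP i K.
    by rewrite ifT ?subrr ?mul0r ?absval0 ?ltW //; lia.
  rewrite sub0r mulNr absvalN; case: ifP => _; last by rewrite mul0r absval0 ltW.
  by apply: N0P; exact: leq_trans Ki.
have [N1 N1P] := unconditional_sum xl e0.
exists x, (bin3_poly C (maxn K0 N1) 0).[x]; split; last by apply: K0P; exact: leq_maxl.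
  by rewrite subrr absval0 ltW.
have := N1P _ (leq_maxr K0 N1).
by rewrite horner_bin3_poly big_mkord => /ltW.
Qed.

(** At y = r x the terms are bounded by M |r|^i, where M bounds the terms of the
    original series, so that the sum norm at y of the truncations is bounded and
    that of their differences is geometrically small.  No estimate of the binomial
    coefficients is needed, not even when x lies on the circle of convergence. *)
Lemma cubic_archimedean : 1 < v 2 -> cubic x l = 0.
Proof.
move=> v2; apply: (cubic_closed (v := v)) => e e0.
have [M [M0 aM]] := unconditional_bounded xl.
have [k0 [N0 kNP]] := damped_sum_cvg v2 xl e0.
have v20 : 0 < v 2 := lt_trans ltr01 v2.
have [||k1 k1P] := @expr_small _ (v 2)^-1 (e / (v x + 1)).
- by rewrite invr_ge0 absval_ge0 invf_lt1.
- by rewrite divr_gt0 // ltr_wpDl // absval_ge0.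
pose k := maxn k0 k1; pose y := damping C k * x.
set rho := v (damping C k).
have rho1 : 0 <= rho < 1 by rewrite absval_ge0 absval_damping.
have rho0 : 0 < 1 - rho by rewrite subr_gt0; case/andP: rho1.
have ay i : v ((bin3 0 i)%:R * y ^+ i) <= M * rho ^+ i.
  rewrite exprMn mulrCA absvalM absvalX mulrC.
  by rewrite ler_wpM2r ?exprn_ge0 ?absval_ge0.
have [nrm nrmP] := sum_norm v y.
have [||K0 K0P] := @cubic_truncation_cvg _ _ _ _ nrm (M * (rho ^+ 0 / (1 - rho))) _ _ e e0.
- move=> K; apply/nrmP => n; apply: le_trans (ler_wpM2l M0 (geometric_tail_le 0 n rho1)).
  rewrite mulr_sumr; apply: ler_sum => i _; rewrite coef_poly; case: ifP => _ //.
  by rewrite mul0r absval0 mulr_ge0 ?exprn_ge0 ?absval_ge0.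
- move=> d d0.
  have [||K1 K1P] := @expr_small _ rho (d * (1 - rho) / (M + 1)) => //.
    by rewrite divr_gt0 ?mulr_gt0 // ltr_wpDl.
  exists K1 => K KK; apply/nrmP => n.
  apply: (@le_trans _ _ (M * (rho ^+ K / (1 - rho)))).
    apply: le_trans (ler_wpM2l M0 (geometric_tail_le K n rho1)).
    rewrite mulr_sumr [leRHS]big_mkcond; apply: ler_sum => i _; rewrite coefB !coef_poly.
    have [iK|Ki] := ltnP i K.
      by rewrite ifT ?subrr ?mul0r ?absval0 //; lia.
    rewrite sub0r mulNr absvalN; case: ifP => _; first exact: ay.
    by rewrite mul0r absval0 mulr_ge0 ?exprn_ge0 ?absval_ge0.
  rewrite mulrA ler_pdivrMr //; have := K1P K KK.
  rewrite ltr_pdivlMr ?ltr_wpDl // => /ltW; apply: le_trans.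
  by rewrite mulrDr mulr1 mulrC lerDl exprn_ge0 ?absval_ge0.
pose K := maxn K0 N0; exists y, (bin3_poly C K 0).[y]; split.
- have -> : y - x = (damping C k - 1) * x by rewrite /y; ring.
  rewrite absvalM absval_dampingB1 //.
  have := k1P k (leq_maxr _ _); rewrite ltr_pdivlMr ?ltr_wpDl ?absval_ge0 //.
  move/ltW; apply: le_trans; rewrite mulrDr mulr1 lerDl.
  by rewrite exprn_ge0 ?invr_ge0 ?absval_ge0.
- have := kNP k K (leq_maxl _ _) (leq_maxr _ _); rewrite horner_bin3_poly.
  by under eq_bigr do rewrite -mulrA -exprMn [x * _]mulrC -/y.
- by apply: K0P; exact: leq_maxl.
Qed.

End Main.

Theorem theorem1 (R : realType) (C : fieldType) (v : absval R C)
    (char_neq3 : 3%N \notin [pchar C]) (p q : C) (p_neq0 : p != 0)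
    (q_neq0 : q != 0) (lambda : C) :
  let f : {poly C} := 'X^3 + p *: 'X + q%:P in
  let Delta : C := - 4%:R * p ^+ 3 - 27%:R * q ^+ 2 in
  unconditional_cvg v
    (fun n : nat => 'C(3 * n, n)%:R * (- Delta / (27%:R * p ^+ 3)) ^+ n)
    lambda ->
  let alpha : C := 3%:R * q / p * lambda in
  f.[alpha] = 0.
Proof.
move=> f Delta xl alpha; set x := - Delta / _ in xl.
have three_neq0 : 3%:R != 0 :> C.
  by apply: contra char_neq3 => three0; rewrite inE.
have {}xl : unconditional_cvg v (fun n => (bin3 0 n)%:R * x ^+ n) lambda.
  by under eq_fun do rewrite /bin3 addn0.
have x_lambda : cubic x lambda = 0.
  have [v2|v2] := leP (v 2) 1; first exact: cubic_nonarchimedean xl v2.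
  exact: cubic_archimedean xl v2.
have -> : f.[alpha] = q * cubic x lambda; last by rewrite x_lambda mulr0.
rewrite /f !hornerD hornerXn hornerZ hornerX hornerC /cubic /x /alpha /Delta.
have e27_neq0 : 27%:R != 0 :> C by rewrite -[27%N]/(3 ^ 3)%N natrX expf_neq0.
by field; rewrite p_neq0 e27_neq0.
Qed.
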